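(* Consider probabilistic direct search (PDS, as described in the context) with $f:\mathbb{R}^n\to\mathbb{R}$ differentiable and convex on $\mathbb{R}^n$. Let $m\ge 1$ be an integer and let each $\mathfrak{D}_k$ be a set of $m$ i.i.d. random vectors uniformly distributed on the unit sphere in $\mathbb{R}^n$, with no dependence on existing polling directions or iterates (i.e. independent of $\mathcal{F}_{k-1}$). Suppose that either $\gamma=1$, or $\gamma>1$ and $$m<\log_2\left(1-\frac{\log\theta}{\log\gamma}\right).$$ Then $$\mathbb{P}\Big(\inf_{k\ge 0}\mu(X_k)>0\Big)>0$$ for any function $\mu:\mathbb{R}^n\to(-\infty,\infty]$ that is lower semicontinuous with $\mu(x_0)>0$. If, further, $\mu$ is locally Lipschitz continuous at $x_0$, then there exist constants $C>0$ and $\overline{\zeta}>0$ such that, with $p=2^{-m}$, $$\mathbb{P}\Big(\inf_{k\ge 0}\mu(X_k)\ge(1-\zeta)\,\mu(x_0)\Big)\ge C\,\zeta^{\frac{\log p}{\log\theta}}\quad\text{for all }\zeta\in(0,\overline{\zeta}).$$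
   Context: PDS. Fix $n\ge 1$, an objective $f:\mathbb{R}^n\to\mathbb{R}$, a deterministic starting point $x_0\in\mathbb{R}^n$, a deterministic initial step size $\alpha_0>0$, constants $\theta\in(0,1)$ and $\gamma\in[1,\infty)$, and a forcing function $\rho:(0,\infty)\to(0,\infty)$, which is nondecreasing with $\rho(\alpha)=o(\alpha)$ as $\alpha\to 0^+$. On a probability space $(\Omega,\mathcal{F},\mathbb{P})$, PDS generates random polling direction sets $\mathfrak{D}_k$, random iterates $X_k$ and random step sizes $A_k$, $k\ge 0$, with $X_0=x_0$, $A_0=\alpha_0$, as follows. For each $k\ge 0$, $\mathfrak{D}_k$ is nonempty and consists of finitely many random vectors in $\mathbb{R}^n$ of Euclidean norm $1$. If some $d\in\mathfrak{D}_k$ satisfies $f(X_k)-f(X_k+A_kd)>\rho(A_k)$, then $X_{k+1}=X_k+A_kd_k$ for some $d_k\in\mathfrak{D}_k$ satisfying this inequality (the selection rule is unspecified and may involve additional randomness) and $A_{k+1}=\gamma A_k$; otherwise $X_{k+1}=X_k$ and $A_{k+1}=\theta A_k$. Filtration: $\mathcal{F}_{-1}=\{\emptyset,\Omega\}$ and $\mathcal{F}_k=\sigma(\mathfrak{D}_0,X_1,\dots,\mathfrak{D}_k,X_{k+1})$ for $k\ge 0$. Locally Lipschitz continuous at $x_0$ means that $\mu$ is finite and Lipschitz continuous on some neighborhood of $x_0$. *)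

(* Defs.v *)
From HB Require Import structures.
From mathcomp Require Import all_boot all_order all_algebra.
From mathcomp Require Import all_classical all_reals all_analysis.

Set Implicit Arguments.
Unset Strict Implicit.
Unset Printing Implicit Defensive.

Import Order.TTheory GRing.Theory Num.Theory.
Import numFieldNormedType.Exports.

Local Open Scope classical_set_scope.
Local Open Scope ring_scope.

(* 'rV[R]_n plays the role of R^n, with its Borel sigma-algebra. *)
HB.instance Definition _ (R : realType) (n : nat) :=
  Measurable.copy 'rV[R]_n (g_sigma_algebraType (@open 'rV[R]_n)).

Section euclidean.
Context {R : realType} {n : nat}.
Implicit Types (a b x : 'rV[R]_n) (A B : set 'rV[R]_n).

(* The library norm `|x| on row vectors is the sup norm. *)
Definition norm2 x : R := Num.sqrt (\sum_(i < n) x 0 i ^+ 2).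

Definition unit_sphere : set 'rV[R]_n := [set x | norm2 x = 1].

Definition closed_box a b : set 'rV[R]_n :=
  [set x | forall i, a 0 i <= x 0 i <= b 0 i].

Definition box_volume a b : R := \prod_(i < n) Num.max 0 (b 0 i - a 0 i).

(* n-dimensional Lebesgue outer measure; it agrees with Lebesgue measure on
   Borel sets, which is where it is used. *)
Definition lebesgue_outer A : \bar R :=
  ereal_inf [set s | exists a b : nat -> 'rV[R]_n,
    A `<=` \bigcup_k closed_box (a k) (b k) /\
    s = (\sum_(0 <= k <oo) (box_volume (a k) (b k))%:E)%E].

Definition radial_cone B : set 'rV[R]_n :=
  [set x | exists t u, [/\ 0 < t, t <= 1, B u & x = t *: u]].

(* Surface measure of a Borel subset B of the unit sphere, by polar
   coordinates: the Lebesgue measure of its radial cone is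
   (\int_0^1 t^(n-1) dt) times its area, i.e. a fraction 1/n of it. *)
Definition surface_measure B : \bar R :=
  (n%:R%:E * lebesgue_outer (radial_cone B))%E.

End euclidean.
Arguments unit_sphere : clear implicits.

Section random_vectors.
Context {d : measure_display} {Omega : measurableType d} {R : realType}.
Context {P : probability Omega R} {n : nat}.

(* The law of V is the normalized surface measure on the unit sphere. *)
Definition uniform_on_sphere (V : {RV P >-> 'rV[R]_n}) :=
  forall B : set 'rV[R]_n, measurable B -> B `<=` unit_sphere R n ->
    P (V @^-1` B) = (surface_measure B / surface_measure (unit_sphere R n))%E.

Definition mutually_independent m (V : 'I_m -> {RV P >-> 'rV[R]_n}) :=
  forall B : 'I_m -> set 'rV[R]_n, (forall j, measurable (B j)) ->
    P (\bigcap_(j in [set: 'I_m]) (V j @^-1` B j)) =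
    (\prod_(j < m) P (V j @^-1` B j))%E.

Definition independent_set_systems (G H : set (set Omega)) :=
  forall E F, G E -> H F -> P (E `&` F) = (P E * P F)%E.

End random_vectors.
Arguments independent_set_systems {d Omega R} P G H.

Definition forcing_function {R : realType} (rho : R -> R) :=
  [/\ forall a, 0 < a -> 0 < rho a,
      forall a b, 0 < a -> a <= b -> rho a <= rho b &
      rho =o_ (0^'+) id].

Section pds.
Context {d : measure_display} {Omega : measurableType d} {R : realType}.
Context {P : probability Omega R} {n m : nat}.
Variables (f : 'rV[R]_n -> R) (x0 : 'rV[R]_n) (alpha0 theta gamma : R).
Variable rho : R -> R.
Variable D : nat -> 'I_m -> {RV P >-> 'rV[R]_n}.
Variable X : nat -> {RV P >-> 'rV[R]_n}.
Variable A : nat -> {RV P >-> R}.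

Definition sufficient_decrease k w j :=
  f (X k w) - f (X k w + A k w *: D k j w) > rho (A k w).

(* The polling set of iteration k is {D k j | j : 'I_m}. *)
Record probabilistic_direct_search : Prop := {
  pds_X0 : forall w, X 0 w = x0;
  pds_A0 : forall w, A 0 w = alpha0;
  pds_unit : forall k j w, norm2 (D k j w) = 1;
  pds_success : forall k w, (exists j, sufficient_decrease k w j) ->
    (exists2 j, sufficient_decrease k w j &
                X k.+1 w = X k w + A k w *: D k j w) /\
    A k.+1 w = gamma * A k w;
  pds_failure : forall k w, ~ (exists j, sufficient_decrease k w j) ->
    X k.+1 w = X k w /\ A k.+1 w = theta * A k w }.

(* pds_filtration k is the sigma-algebra F_{k-1} generated by
   D 0, X 1, .., D (k-1), X k; it is trivial for k = 0. *)
Definition pds_filtration k : set (set Omega) :=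
  <<s \bigcup_(i in `I_k)
        (g_sigma_preimage (D i) `|` g_sigma_algebra_preimage (X i.+1)) >>.

End pds.
Arguments pds_filtration {d Omega R P n m} D X k.

Definition locally_lipschitz_at {R : realType} {n : nat}
    (mu : 'rV[R]_n -> \bar R) (x0 : 'rV[R]_n) :=
  exists2 V : set 'rV[R]_n, nbhs x0 V &
    (forall x, V x -> mu x \is a fin_num) /\ [lipschitz fine (mu x) | x in V].

(* Main.v *)
Require Import Defs.
From HB Require Import structures.
From mathcomp Require Import all_boot all_order all_algebra.
From mathcomp Require Import all_classical all_reals all_analysis.
From mathcomp Require Import measurable_realfun ring lra.

(** Let B_k be the event that all the directions polled at iteration k have a
    nonnegative scalar product with the gradient of f at X_k.  By convexity,
    f does not decrease along any of them, so on B_k the iteration fails: the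
    iterate stays put and the step size is multiplied by theta.  Off B_k the
    step size grows at most by the factor gamma, and the iterate moves by at
    most A_k.

    The law of each direction is invariant under u |-> - u, hence any fixed
    closed half-space through the origin has probability at least 1/2, and m
    independent directions all lie in it with probability at least
    p = 2^-m ([iid_uniform_halfspace]).  As the directions are independent of
    the past, which determines the gradient at X_k, the event B_k has
    probability at least p conditionally on the past
    ([conditional_halfspace]).  This is proved without conditional
    expectations: the gradient is rounded to a countable grid, the bound is
    summed over the grid cells, and the mesh is sent to 0.

    The condition on m says that (1 - p) ln gamma + p ln theta < 0, so that
    the logarithm of the step size drifts downwards.  Hence for a small s > 0
    and some eta < 1 one has p theta^s + (1 - p) gamma^s <= eta^s
    ([drift_exponent]): the quantity (A_k / eta^k)^s is a supermartingale.  The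
    maximal inequality ([prob_overshoot], by induction on the horizon) shows
    that, starting from a step size a, all later step sizes stay below
    r eta^j except with probability at most (a / r)^s; the total length of the
    moves is then at most r / (1 - eta).

    With probability at least p^K the first K iterations fail, which leaves
    the iterate at x0 with the step size theta^K alpha0.  Together with the
    previous bound, all the iterates stay within r / (1 - eta) of x0 with
    probability at least p^K (1 - (theta^K alpha0 / r)^s)
    ([prob_confined]).  The first claim follows by lower semicontinuity of mu
    at x0 and a large K.  For the second one, the Lipschitz condition allows r
    proportional to zeta, and the least K with theta^K <= c zeta, for a
    suitable constant c, gives p^K = (theta^K)^(ln p / ln theta), which is at
    least a constant times zeta^(ln p / ln theta). *)

Set Implicit Arguments.
Unset Strict Implicit.
Unset Printing Implicit Defensive.

Import Order.TTheory GRing.Theory Num.Theory.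
Import numFieldNormedType.Exports.

Local Open Scope classical_set_scope.
Local Open Scope ring_scope.

(** * Downward drift of the step size *)

(** Negative drift of the logarithm of the step size gives a contraction of
    its moment of some small order [s]. *)
Lemma drift_exponent (R : realType) (theta gamma p : R) :
  0 < theta < 1 -> 1 <= gamma -> 0 < p < 1 ->
  (1 - p) * ln gamma + p * ln theta < 0 ->
  exists s eta : R, [/\ 0 < s, 0 < eta < 1 &
    p * theta `^ s + (1 - p) * gamma `^ s <= eta `^ s].
Proof.
move=> /andP[theta0 theta1] gamma1 /andP[p0 p1] drift.
have gamma0 : 0 < gamma by lra.
have a0 : 0 <= ln gamma by rewrite ln_ge0.
have b0 : 0 < - ln theta by rewrite oppr_gt0 ln_lt0 // theta0.
set a := ln gamma in drift a0 *; set b := - ln theta in b0 *.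
pose del := p * b - (1 - p) * a.
have del0 : 0 < del by rewrite /del /b; lra.
have ab0 : 0 <= a * b by rewrite mulr_ge0 // ltW.
have ad0 : 0 <= a * del by rewrite mulr_ge0 // ltW.
pose s := del / (1 + a * b + a * del).
have den0 : 0 < 1 + a * b + a * del by lra.
have s0 : 0 < s by rewrite divr_gt0.
have sE : s * (1 + a * b + a * del) = del by rewrite /s divfK // gt_eqF.
have sa0 : 0 <= s * a by rewrite mulr_ge0 // ltW.
have sad0 : 0 <= s * (a * del) by rewrite mulr_ge0 // ltW.
have sab0 : 0 <= s * (a * b) by rewrite mulr_ge0 // ltW.
have sa1 : s * a < 1.
  rewrite /s mulrAC ltr_pdivrMr //; lra.
have sb0 : 0 < s * b by rewrite mulr_gt0.
(* exp x <= 1 / (1 - x) reduces the claim to an inequality between rational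
   functions of s. *)
have powE (c : R) : 0 < c -> c `^ s = expR (s * ln c).
  by move=> c0; rewrite /powR gt_eqF.
have gammas : gamma `^ s <= (1 - s * a)^-1.
  rewrite powE // -/a -[s * a]opprK expRN lef_pV2 ?posrE ?expR_gt0 ?opprK //.
    by have := expR_ge1Dx (- (s * a)); lra.
  by lra.
have thetas : theta `^ s <= (1 + s * b)^-1.
  have -> : theta `^ s = (expR (s * b))^-1.
    by rewrite powE // -expRN /b mulrN opprK.
  by rewrite lef_pV2 ?posrE ?expR_gt0 ?expR_ge1Dx //; lra.
pose q := p * theta `^ s + (1 - p) * gamma `^ s.
have q0 : 0 < q.
  rewrite addr_gt0 // mulr_gt0 ?powR_gt0 //; lra.
have q1 : q < 1.
  have : q <= p * (1 + s * b)^-1 + (1 - p) * (1 - s * a)^-1.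
    by rewrite lerD // ler_wpM2l //; lra.
  move=> /le_lt_trans; apply.
  have -> : p * (1 + s * b)^-1 + (1 - p) * (1 - s * a)^-1 =
    (p * (1 - s * a) + (1 - p) * (1 + s * b)) / ((1 + s * b) * (1 - s * a)).
    by field; apply/andP; split; rewrite gt_eqF //; lra.
  rewrite ltr_pdivrMr ?mul1r; last by rewrite mulr_gt0 //; lra.
  rewrite -subr_gt0.
  have -> : (1 + s * b) * (1 - s * a) - (p * (1 - s * a) + (1 - p) * (1 + s * b))
            = s * (del - s * (a * b)) by rewrite /del; ring.
  by rewrite mulr_gt0 //; lra.
exists s, (q `^ s^-1); split => //.
- rewrite powR_gt0 //= /powR gt_eqF // expR_lt1 pmulr_rlt0 ?invr_gt0 //.
  by rewrite ln_lt0 // q0.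
- by rewrite -powRrM mulVf ?gt_eqF // powRr1 // ltW.
Qed.

Section step_size_overshoot.
Context {d : measure_display} {Omega : measurableType d} {R : realType}.
Variables (P : probability Omega R) (B : nat -> set Omega).
Variables (theta gamma eta : R).

(** [overshoot N k a r]: along the walk that starts at [a] at time [k] and is
    multiplied by [theta] at the times [i] where [B i] holds and by [gamma]
    otherwise, some of the values at times [k + j] with [j <= N] exceeds
    [r * eta ^+ j].  Defined by recursion on the horizon, so that no
    measurability of the walk itself is needed. *)
Fixpoint overshoot N k a r : set Omega :=
  [set w | r < a] `|`
  (if N is N'.+1 then
     (B k `&` overshoot N' k.+1 (theta * a) (r * eta)) `|`
     (~` B k `&` overshoot N' k.+1 (gamma * a) (r * eta))
   else set0).

Lemma overshootS N k a r : overshoot N k a r `<=` overshoot N.+1 k a r.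
Proof.
elim: N k a r => [|N IH] k a r w /=; first by case=> [|[]//]; left.
move=> [|[] [Bw ow]]; first by left.
- by right; left; split => //; apply: IH.
- by right; right; split => //; apply: IH.
Qed.

Hypothesis mB : forall k, measurable (B k).

Lemma measurable_overshoot N k a r : measurable (overshoot N k a r).
Proof.
have mc (k' : nat) (a' r' : R) : measurable [set w : Omega | r' < a'].
  by case: (ltP r' a') => _; [rewrite [X in measurable X](_ : _ = setT) |
    rewrite [X in measurable X](_ : _ = set0)]; rewrite // predeqE.
elim: N k a r => [|N IH] k a r /=; apply: measurableU; rewrite //; try exact: mc.
by apply: measurableU; apply: measurableI => //; apply: measurableC.
Qed.

Let pr (E : set Omega) := fine (P E).

Let pr_split E F : measurable E -> measurable F ->
  pr E = pr (E `&` F) + pr (E `\` F).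
Proof.
move=> mE mF; rewrite /pr -fineD ?fin_num_measure //; first last.
- exact: measurableD.
- exact: measurableI.
congr fine; rewrite addeC; exact: measureDI.
Qed.

Let le_pr E F : measurable E -> measurable F -> E `<=` F -> pr E <= pr F.
Proof.
move=> mE mF EF; rewrite /pr fine_le ?fin_num_measure // le_measure ?inE //.
Qed.

Let pr_ge0 E : 0 <= pr E. Proof. exact: fine_ge0. Qed.

(** If, conditionally on the past, [B k] has probability at least [p], then
    the walk overshoots the envelope [r * eta ^+ j] with conditional
    probability at most [(a / r) `^ s].  [G k] stands for the events determined
    before time [k]; the proof is an induction on the horizon that splits [E]
    according to [B k]. *)
Lemma prob_overshoot (G : nat -> set (set Omega)) (p s : R) N k a r E :
  0 < theta <= gamma -> 0 < eta -> 0 < s ->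
  p * theta `^ s + (1 - p) * gamma `^ s <= eta `^ s ->
  (forall k E, G k E -> measurable E) ->
  (forall k E, G k E -> G k.+1 (E `&` B k)) ->
  (forall k E, G k E -> G k.+1 (E `\` B k)) ->
  (forall k E, G k E -> p * pr E <= pr (E `&` B k)) ->
  0 < a -> 0 < r -> G k E ->
  pr (E `&` overshoot N k a r) * r `^ s <= pr E * a `^ s.
Proof.
move=> /andP[theta0 thetag] eta0 s0 contr mG GI GD hp.
have gamma0 : 0 < gamma by exact: lt_le_trans thetag.
elim: N k a r E => [|N IH] k a r E a0 r0 GE.
  rewrite /= setU0; case: (ltP r a) => ra.
    rewrite [X in E `&` X](_ : _ = setT); last by rewrite predeqE.
    by rewrite setIT ler_wpM2l // ge0_ler_powR ?nnegrE // ltW.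
  rewrite [X in E `&` X](_ : _ = set0); last by rewrite predeqE => w; split.
  by rewrite setI0 /pr measure0 /= mul0r mulr_ge0 ?powR_ge0 //; exact: pr_ge0.
have mE := mG _ _ GE.
case: (ltP r a) => ra.
  have : pr (E `&` overshoot N.+1 k a r) <= pr E.
    apply: le_pr => //; apply: measurableI => //; exact: measurable_overshoot.
  move=> /ler_wpM2r -/(_ (r `^ s) (powR_ge0 _ _)) /le_trans; apply.
  by rewrite ler_wpM2l // ge0_ler_powR ?nnegrE // ltW.
pose x := pr (E `&` B k); pose e := pr E.
have ex : e = x + pr (E `\` B k) by rewrite /e (pr_split mE (mB k)).
set O1 := overshoot N k.+1 (theta * a) (r * eta).
set O2 := overshoot N k.+1 (gamma * a) (r * eta).
have mO1 : measurable O1 by exact: measurable_overshoot.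
have mO2 : measurable O2 by exact: measurable_overshoot.
have split12 : pr (E `&` overshoot N.+1 k a r) =
    pr (E `&` B k `&` O1) + pr ((E `\` B k) `&` O2).
  rewrite (@pr_split _ (B k)) //; last first.
    by apply: measurableI => //; exact: measurable_overshoot.
  congr (pr _ + pr _); apply/seteqP; split => w /=.
  - by move=> [[Ew [ra'|[[_ o1]|[nB _]]]] Bw] //; rewrite ltNge ra in ra'.
  - by move=> [[Ew Bw] o1]; split => //; split => //; right; left.
  - by move=> [[Ew [ra'|[[Bw _]|[nB o2]]]] nBw] //; rewrite ltNge ra in ra'.
  - by move=> [[Ew nBw] o2]; split => //; split => //; right; right.
have IH1 := IH k.+1 (theta * a) (r * eta) _ (mulr_gt0 theta0 a0)
  (mulr_gt0 r0 eta0) (GI _ _ GE).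
have IH2 := IH k.+1 (gamma * a) (r * eta) _ (mulr_gt0 gamma0 a0)
  (mulr_gt0 r0 eta0) (GD _ _ GE).
rewrite -/O1 -/x in IH1; rewrite -/O2 in IH2.
have {}ex : pr (E `\` B k) = e - x by rewrite ex addrC addKr.
rewrite split12 -/e; rewrite ex in IH2.
rewrite !powRM ?(ltW eta0) ?(ltW r0) ?(ltW theta0) ?(ltW gamma0) ?(ltW a0) // in IH1 IH2.
rewrite -(@ler_pM2r _ (eta `^ s)) ?powR_gt0 //.
set y1 := pr _ in IH1 *; set y2 := pr _ in IH2 *.
have tg : theta `^ s <= gamma `^ s.
  by rewrite ge0_ler_powR ?nnegrE // ltW.
have px : p * e <= x by exact: hp.
have as0 : 0 <= a `^ s by exact: powR_ge0.
set ts := theta `^ s in contr tg IH1 *; set gs := gamma `^ s in contr tg IH2 *.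
set es := eta `^ s in contr IH1 IH2 *; set rs := r `^ s in IH1 IH2 *.
set ass := a `^ s in as0 IH1 IH2 *.
have e0 : 0 <= e by exact: pr_ge0.
apply: (@le_trans _ _ ((x * ts + (e - x) * gs) * ass)); first by lra.
have main : x * ts + (e - x) * gs <= e * es.
  have h1 : 0 <= (x - p * e) * (gs - ts) by rewrite mulr_ge0 // subr_ge0.
  have h2 : 0 <= e * (es - (p * ts + (1 - p) * gs)).
    by rewrite mulr_ge0 // subr_ge0.
  by lra.
by rewrite [leRHS](_ : _ = e * es * ass); [exact: ler_wpM2r | ring].
Qed.

End step_size_overshoot.

(** * Scalar products and the uniform law on the sphere *)

Section row_vector_measurability.
Context {R : realType} {n : nat}.

Lemma continuous_measurable_rV (h : 'rV[R]_n -> R) :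
  continuous h -> measurable_fun setT h.
Proof.
move=> /continuousP ch.
apply: (measurability _ (RGenOpens.measurableE R)) => _ [_ [a [b ->] <-]].
by rewrite setTI; apply: sub_sigma_algebra; exact/ch/interval_open.
Qed.

Lemma lower_semicontinuous_measurable_rV (h : 'rV[R]_n -> \bar R) :
  lower_semicontinuous h -> measurable_fun setT h.
Proof.
move=> /lower_semicontinuousP lsc.
apply: (measurability _ (ErealGenOInfty.measurableE R)) => _ [_ [a ->] <-].
by rewrite setTI preimage_itvoy; apply: sub_sigma_algebra; exact: lsc.
Qed.

Lemma measurable_coord (i : 'I_n) :
  measurable_fun setT (fun x : 'rV[R]_n => x 0 i).
Proof. by apply: continuous_measurable_rV; exact: coord_continuous. Qed.

(** The Euclidean scalar product. *)
Definition dotv (u v : 'rV[R]_n) : R := \sum_(i < n) u 0 i * v 0 i.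

Lemma dotvNr u v : dotv u (- v) = - dotv u v.
Proof. by rewrite /dotv -sumrN; apply: eq_bigr => i _; rewrite mxE mulrN. Qed.

Lemma dotvNl u v : dotv (- u) v = - dotv u v.
Proof. by rewrite /dotv -sumrN; apply: eq_bigr => i _; rewrite mxE mulNr. Qed.

Lemma dotvZr (a : R) u v : dotv u (a *: v) = a * dotv u v.
Proof. by rewrite /dotv mulr_sumr; apply: eq_bigr => i _; rewrite mxE mulrCA. Qed.

Lemma norm2N (x : 'rV[R]_n) : norm2 (- x) = norm2 x.
Proof.
by rewrite /norm2; congr Num.sqrt; apply: eq_bigr => i _; rewrite mxE sqrrN.
Qed.

Lemma ler_coord_norm2 (x : 'rV[R]_n) i : `|x 0 i| <= norm2 x.
Proof.
rewrite -sqrtr_sqr ler_wsqrtr // (bigD1 i) //= lerDl sumr_ge0 // => k _.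
exact: sqr_ge0.
Qed.

Lemma ler_mx_norm2 (x : 'rV[R]_n) : `|x| <= norm2 x.
Proof.
rewrite /Num.Def.normr /= mx_normrE; apply/bigmax_leP; split => [|[i j] _ /=].
  exact: sqrtr_ge0.
by rewrite ord1 ler_coord_norm2.
Qed.

Lemma measurable_dotv (v : 'rV[R]_n) : measurable_fun setT (dotv v).
Proof.
apply: measurable_sum => i.
by apply: measurable_funM => //; exact: measurable_coord.
Qed.

Lemma measurable_norm2 : measurable_fun setT (@norm2 R n).
Proof.
have -> : @norm2 R n = Num.sqrt \o (fun x => \sum_(i < n) x 0 i * x 0 i).
  by apply/funext => x /=; under [in RHS]eq_bigr do rewrite -expr2.
apply: measurableT_comp.
  by apply: continuous_measurable_fun; exact: sqrt_continuous.
by apply: measurable_sum => i; apply: measurable_funM; exact: measurable_coord.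
Qed.

Lemma measurable_unit_sphere : measurable (unit_sphere R n).
Proof.
rewrite [X in measurable X](_ : _ = setT `&` @norm2 R n @^-1` [set 1]).
  by apply: measurable_norm2 => //; exact: measurable_set1.
by rewrite setTI.
Qed.

Lemma measurable_halfspace (v : 'rV[R]_n) : measurable [set u | 0 <= dotv v u].
Proof.
rewrite [X in measurable X](_ : _ = setT `&` dotv v @^-1` `[0, +oo[).
  by apply: measurable_dotv => //; exact: measurable_itv.
by rewrite setTI; apply/seteqP; split => u /=; rewrite in_itv /= andbT.
Qed.

Lemma lebesgue_outer_opp (B : set 'rV[R]_n) :
  lebesgue_outer [set x | B (- x)] = lebesgue_outer B.
Proof.
have covers (C : set 'rV[R]_n) s :
    (exists a b : nat -> 'rV[R]_n, C `<=` \bigcup_k closed_box (a k) (b k) /\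
       s = (\sum_(0 <= k <oo) (box_volume (a k) (b k))%:E)%E) ->
    exists a b : nat -> 'rV[R]_n,
      [set x | C (- x)] `<=` \bigcup_k closed_box (a k) (b k) /\
      s = (\sum_(0 <= k <oo) (box_volume (a k) (b k))%:E)%E.
  move=> [a [b [Cab ->]]]; exists (fun k => - b k), (fun k => - a k); split.
    move=> x /Cab [k _ abk]; exists k => // i; have := abk i.
    by rewrite !mxE => /andP[ax xb]; rewrite lerNl lerNr xb ax.
  apply: eq_eseriesr => k _; congr (_%:E); apply: eq_bigr => i _.
  by rewrite !mxE opprK addrC.
congr ereal_inf; apply/seteqP; split => s /covers //=.
suff -> : [set x | [set y | B (- y)] (- x)] = B by [].
by apply/seteqP; split => x /=; rewrite opprK.
Qed.

Lemma surface_measure_opp (B : set 'rV[R]_n) :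
  surface_measure [set x | B (- x)] = surface_measure B.
Proof.
rewrite /surface_measure -(lebesgue_outer_opp (radial_cone B)).
congr (_ * lebesgue_outer _)%E; apply/seteqP; split => x /=.
  by move=> [t [u [t0 t1 Bu ->]]]; exists t, (- u); split; rewrite ?scalerN.
move=> [t [u [t0 t1 Bu xtu]]]; exists t, (- u); split => //=.
  by rewrite opprK.
by rewrite scalerN -xtu opprK.
Qed.

End row_vector_measurability.

Section polling_directions.
Context {d : measure_display} {Omega : measurableType d} {R : realType}.
Context {P : probability Omega R} {n : nat}.

(** The half-space and its opposite have the same probability by symmetry of
    the surface measure, and they cover the sphere. *)
Lemma uniform_halfspace (V : {RV P >-> 'rV[R]_n}) (v : 'rV[R]_n) :
  uniform_on_sphere V -> (forall w, norm2 (V w) = 1) ->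
  2^-1 <= fine (P (V @^-1` [set u | 0 <= dotv v u])).
Proof.
move=> unif V1.
have mV (C : set 'rV[R]_n) : measurable C -> measurable (V @^-1` C).
  by move=> mC; rewrite -[_ @^-1` _]setTI; exact: measurable_funPT.
pose half u := unit_sphere R n `&` [set x | 0 <= dotv u x].
have mh u : measurable (half u).
  apply: measurableI; [exact: measurable_unit_sphere |exact: measurable_halfspace].
have halfN : half (- v) = [set x | half v (- x)].
  by apply/seteqP; split => x; rewrite /half /unit_sphere /= norm2N dotvNr dotvNl.
have hs u : half u `<=` unit_sphere R n by move=> x [].
have PE : P (V @^-1` half (- v)) = P (V @^-1` half v).
  by rewrite !unif // halfN surface_measure_opp.
have -> : V @^-1` [set u | 0 <= dotv v u] = V @^-1` half v.
  by apply/seteqP; split => w /= => [h|[]//]; split => //; exact: V1.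
have cov : V @^-1` half v `|` V @^-1` half (- v) = setT.
  apply/seteqP; split => // w _ /=.
  case: (leP 0 (dotv v (V w))) => h; [left|right]; split; rewrite /= ?dotvNl //;
    by [exact: V1 | rewrite oppr_ge0 ltW].
have PU C C' : measurable C -> measurable C' -> (P (setU C C') <= P C + P C')%E.
  exact: measureU2.
have := PU _ _ (mV _ (mh v)) (mV _ (mh (- v))).
rewrite cov PE probability_setT -[P _]fineK ?fin_num_measure //; last exact: mV.
by rewrite -EFinD lee_fin => ?; lra.
Qed.

(** All the directions of a polling set lie in a fixed half-space with
    probability at least [2 ^- m]. *)
Lemma iid_uniform_halfspace m (V : 'I_m -> {RV P >-> 'rV[R]_n}) (v : 'rV[R]_n) :
  (forall j, uniform_on_sphere (V j)) -> (forall j w, norm2 (V j w) = 1) ->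
  mutually_independent V ->
  2 ^- m <= fine (P [set w | forall j, 0 <= dotv v (V j w)]).
Proof.
move=> unif V1 indep; pose H := [set u | 0 <= dotv v u].
have mH : measurable H by exact: measurable_halfspace.
have -> : [set w | forall j, 0 <= dotv v (V j w)] =
    \bigcap_(j in [set: 'I_m]) (V j @^-1` H).
  by apply/seteqP; split => [w h j _|w h j]; [exact: h|exact: (h j I)].
rewrite (indep (fun=> H)) //.
have -> : (\prod_(j < m) P (V j @^-1` H) =
    (\prod_(j < m) fine (P (V j @^-1` H)))%:E)%E.
  rewrite -prodEFin; apply: eq_bigr => j _; rewrite fineK // fin_num_measure //.
  by rewrite -[_ @^-1` _]setTI; exact: measurable_funPT.
rewrite /= -exprVn -[m in X in X <= _]card_ord -prodr_const.
apply: ler_prod => j _; rewrite invr_ge0 ler0n /=; exact: uniform_halfspace.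
Qed.

End polling_directions.

(** * The gradient *)

Section gradient.
Context {R : realType} {n : nat}.
Variable f : 'rV[R]_n -> R.

(** The row of the partial derivatives, so that [dotv (gradient x)] is the
    differential at [x] ([dotv_gradient]). *)
Definition gradient (x : 'rV[R]_n) : 'rV[R]_n :=
  \row_i 'd f x (delta_mx 0 i).

Hypothesis df : forall x, differentiable f x.

Lemma dotv_gradient x h : dotv (gradient x) h = 'd f x h.
Proof.
rewrite [in RHS](row_sum_delta h) linear_sum; apply: eq_bigr => i _.
by rewrite linearZ mxE mulrC.
Qed.

Lemma difference_quotient_cvg x h :
  (fun k => k.+1%:R * (f (x + k.+1%:R^-1 *: h) - f x)) @ \oo --> 'd f x h.
Proof.
rewrite -deriveE //.
have dx : (fun t => t^-1 *: ((f \o shift x) (t *: h) - f x)) t @[t --> 0^'] -->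
    ('D_h f x : R^o) by exact: diff_derivable.
have /(_ harmonic) := (cvgr_dnbhsP _ _ _).1 dx.
have har : (forall k, @harmonic R k != 0) /\ @harmonic R @ \oo --> (0 : R).
  by split=> [k|]; [rewrite gt_eqF // harmonic_gt0 | exact: cvg_harmonic].
move=> /(_ har); apply: cvg_trans; apply: near_eq_cvg; near=> k.
by rewrite /= /harmonic /= invrK [_ *: h + x]addrC.
Unshelve. all: by end_near. Qed.

(** The partial derivatives are limits of continuous difference quotients. *)
Lemma measurable_gradient i : measurable_fun setT (fun x => gradient x 0 i).
Proof.
pose h k x := k.+1%:R * (f (x + k.+1%:R^-1 *: delta_mx 0 i) - f x).
apply: (@measurable_fun_cvg _ _ _ _ h) => [k|x _]; last first.
  by rewrite mxE; exact: difference_quotient_cvg.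
apply: continuous_measurable_rV => x.
pose e : 'rV[R]_n := k.+1%:R^-1 *: delta_mx 0 i.
have dshift : differentiable (fun y : 'rV[R]_n => y + e) x.
  by [].
have dfs : differentiable (fun y => f (y + e)) x by exact: differentiable_comp.
suff : differentiable (k.+1%:R *: ((fun y => f (y + e)) - f) : _ -> R^o) x.
  exact: differentiable_continuous.
by apply: differentiableZ; apply: differentiableB.
Qed.

Lemma convex_gradient x h : convex_function [set: 'rV[R]_n] f ->
  f x + dotv (gradient x) h <= f (x + h).
Proof.
move=> cf; rewrite dotv_gradient -lerBrDl.
apply: (cvgr_to_le (difference_quotient_cvg (x := x) (h := h))).
near=> k; have k0 : (0 : R) < k.+1%:R by rewrite ltr0n.
have t01 : 0 <= (k.+1%:R^-1 : R) <= 1.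
  by rewrite invr_ge0 ler0n /= invf_le1 // ler1n.
pose t := Itv01 (andP t01).1 (andP t01).2.
have : f (k.+1%:R^-1 *: (x + h) + (1 - k.+1%:R^-1) *: x) <=
    k.+1%:R^-1 * f (x + h) + (1 - k.+1%:R^-1) * f x.
  by have := cf t (x + h) x; rewrite !inE => /(_ I I).
have -> : k.+1%:R^-1 *: (x + h) + (1 - k.+1%:R^-1) *: x = x + k.+1%:R^-1 *: h.
  by rewrite scalerDr scalerBl scale1r addrACA addrC addrA subrK addrC.
rewrite -(ler_pM2l k0) !mulrDr mulrBl mulrBr !mulrA !mulfV ?gt_eqF //.
lra.
Unshelve. all: by end_near. Qed.

End gradient.

(** * Conditioning on the past *)

Section conditioning_on_past.
Context {d : measure_display} {Omega : measurableType d} {R : realType}.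
Variable P : probability Omega R.

(** An inequality between probabilities may be checked on the fibers of a
    countably valued map. *)
Lemma le_probability_fibers (Z : countType) (z : Omega -> Z) (c : R)
    (E F : set Omega) :
  0 <= c -> measurable E -> measurable F ->
  (forall v, measurable (z @^-1` [set v])) ->
  (forall v, c%:E * P (E `&` z @^-1` [set v]) <= P (F `&` z @^-1` [set v]))%E ->
  (c%:E * P E <= P F)%E.
Proof.
move=> c0 mE mF mz cEF.
pose cell k := [set w | pickle (z w) = k].
have cellE k : cell k = if (unpickle k : option Z) is Some v then
    (if pickle v == k then z @^-1` [set v] else set0) else set0.
  apply/seteqP; split => [w /= <-|w]; first by rewrite pickleK eqxx.
  by case: unpickle => // v; case: eqP => // pvk /= zw; rewrite /cell /= zw.
have mcell k : measurable (cell k).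
  by rewrite cellE; case: unpickle => // v; case: ifP.
have PE S : measurable S -> P S = (\sum_(k <oo) P (S `&` cell k))%E.
  move=> mS; rewrite -measure_semi_bigcup.
  - by rewrite -setI_bigcupr (_ : \bigcup_k _ = setT) ?setIT //;
      apply/seteqP; split => // w _; exists (pickle (z w)).
  - by move=> k; exact: measurableI.
  - by apply/trivIsetP => i j _ _ /eqP ij; apply/seteqP; split => // w /=
      [[_ ei] [_ ej]]; apply: ij; rewrite -ei -ej.
  - by apply: bigcupT_measurable => k; exact: measurableI.
rewrite (PE _ mE) (PE _ mF) -nneseriesZl; last by move=> *; exact: measure_ge0.
apply: lee_nneseries => [k _ _|k _]; first by rewrite mule_ge0 // lee_fin.
rewrite cellE; case: unpickle => [v|]; last by rewrite !setI0 measure0 mule0.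
by case: ifP => _ //; rewrite !setI0 measure0 mule0.
Qed.

Context {n m : nat}.
Variables (M : set (set Omega)) (V : 'I_m -> {RV P >-> 'rV[R]_n}).
Variables (g : Omega -> 'rV[R]_n) (c : R).

Hypothesis sub_M : forall E, <<s M >> E -> measurable E.
Hypothesis mg : forall i (B : set R), measurable B ->
  <<s M >> [set w | B (g w 0 i)].
Hypothesis V1 : forall j w, norm2 (V j w) = 1.
Hypothesis indep : independent_set_systems P (g_sigma_preimage V) <<s M >>.
Hypothesis c0 : 0 <= c.
Hypothesis halfspace :
  forall v, c <= fine (P [set w | forall j, 0 <= dotv v (V j w)]).

(* The event that all the directions lie in [B]. *)
Let poll_in (B : set 'rV[R]_n) : set Omega := [set w | forall j, B (V j w)].

Let g_sigma_poll_in B : measurable B -> g_sigma_preimage V (poll_in B).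
Proof.
move=> mB.
rewrite [X in g_sigma_preimage V X](_ : _ = \bigcap_(j in [set: 'I_m]) (V j @^-1` B)).
  apply: (@fin_bigcap_measurable _ (g_sigma_algebraType
    (\big[setU/set0]_(i < m) preimage_set_system setT (V i) measurable))) => //.
  move=> j _; apply: sub_sigma_algebra; rewrite (bigD1 j) //=; left.
  by exists B => //; rewrite setTI.
by apply/seteqP; split => [w h j _|w h j]; [exact: h | exact: (h j I)].
Qed.

Let measurable_poll_in B : measurable B -> measurable (poll_in B).
Proof.
move=> mB.
rewrite [X in measurable X](_ : _ = \bigcap_(j in [set: 'I_m]) (V j @^-1` B)).
  apply: fin_bigcap_measurable => // j _.
  by rewrite -[_ @^-1` _]setTI; exact: measurable_funPT.
by apply/seteqP; split => [w h j _|w h j]; [exact: h | exact: (h j I)].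
Qed.

Let mgfun i : measurable_fun setT (fun w => g w 0 i).
Proof. by move=> _ B mB; rewrite setTI; apply: sub_M; exact: mg. Qed.

Let measurable_ge_dotv a :
  measurable [set w | forall j, a <= dotv (g w) (V j w)].
Proof.
rewrite [X in measurable X](_ : _ = \bigcap_(j in [set: 'I_m])
    ((fun w => dotv (g w) (V j w)) @^-1` `[a, +oo[)).
  apply: fin_bigcap_measurable => // j _; rewrite -[_ @^-1` _]setTI.
  have : measurable_fun setT (fun w => dotv (g w) (V j w)).
    apply: measurable_sum => i; apply: measurable_funM => //.
    exact: measurableT_comp (measurable_coord i) (measurable_funPT (V j)).
  by apply => //; exact: measurable_itv.
apply/seteqP; split => [w h j _|w h j] /=; first by rewrite in_itv /= andbT.
by have := h j I; rewrite /= in_itv /= andbT.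
Qed.

Let coord_V j w i : `|V j w 0 i| <= 1.
Proof. by rewrite -(V1 j w) ler_coord_norm2. Qed.

(** Rounding [g] down to a multiple of [1 / N.+1] makes it countably valued,
    so that it can be treated as constant on events of the past; the rounding
    error moves the scalar products by at most [n / N.+1]. *)
Let rounded_halfspace N E : <<s M >> E ->
  (c%:E * P E <= P (E `&` [set w | (forall j,
     - (n%:R / N.+1%:R) <= dotv (g w) (V j w))%R]))%E.
Proof.
move=> ME; pose K : R := N.+1%:R; have K0 : 0 < K by rewrite ltr0n.
set A := [set w | _].
pose z w : {ffun 'I_n -> int} := [ffun i => Num.floor (K * g w 0 i)].
have Mz v : <<s M >> (z @^-1` [set v]).
  rewrite [X in <<s M >> X](_ : _ = \bigcap_(i in [set: 'I_n])
      [set w | ([set x | Num.floor (K * x) = v i]) (g w 0 i)]); last first.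
    apply/seteqP; split => [w /= <- i _ /=|w h /=]; first by rewrite ffunE.
    by apply/ffunP => i; rewrite ffunE; exact: (h i I).
  apply: (@fin_bigcap_measurable _ (g_sigma_algebraType M)) => // i _.
  apply: mg; rewrite [X in measurable X](_ : _ =
    `[(v i)%:~R / K, (v i + 1)%:~R / K[%classic); first exact: measurable_itv.
  apply/seteqP; split => x /=; rewrite in_itv /= ler_pdivrMr // ltr_pdivlMr //
    [x * K]mulrC.
    by move=> <-; exact: floor_itv.
  exact: floor_def.
apply: (@le_probability_fibers _ z) => //.
- exact: sub_M.
- by apply: measurableI; [exact: sub_M | exact: measurable_ge_dotv].
- by move=> v; apply: sub_M; exact: Mz.
move=> v; pose gv : 'rV[R]_n := \row_i ((v i)%:~R / K).
pose H := [set u | 0 <= dotv gv u].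
have mH : measurable H by exact: measurable_halfspace.
pose Ev := E `&` z @^-1` [set v].
have MEv : <<s M >> Ev.
  by apply: (@measurableI _ (g_sigma_algebraType M)); [exact: ME | exact: Mz].
have cH : (c%:E <= P (poll_in H))%E.
  rewrite -[P _]fineK ?lee_fin; first exact: halfspace.
  by apply: fin_num_measure; exact: measurable_poll_in.
apply: (@le_trans _ _ (P (poll_in H) * P Ev)%E).
  by apply: lee_pmul => //; rewrite lee_fin.
rewrite -indep //; last exact: g_sigma_poll_in.
apply: le_measure; rewrite ?inE.
- by apply: measurableI; [exact: measurable_poll_in | exact: sub_M].
- apply: measurableI; last by apply: sub_M; exact: Mz.
  by apply: measurableI; [exact: sub_M | exact: measurable_ge_dotv].
move=> w [Hw [Ew zw]]; split => //; split => // j.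
have -> : dotv (g w) (V j w) =
    dotv gv (V j w) + \sum_(i < n) (g w 0 i - gv 0 i) * V j w 0 i.
  by rewrite /dotv -big_split /=; apply: eq_bigr => i _; rewrite -mulrDl subrKC.
apply: (@le_trans _ _ (\sum_(i < n) (g w 0 i - gv 0 i) * V j w 0 i)); last first.
  by rewrite lerDr; exact: Hw.
have -> : - (n%:R / K) = \sum_(i < n) - K^-1.
  by rewrite sumr_const card_ord mulNrn mulr_natl.
apply: ler_sum => i _; rewrite mxE.
have /andP[fl1 fl2] := floor_itv (K * g w 0 i).
have -> : v i = Num.floor (K * g w 0 i) by rewrite -zw ffunE.
set e := g w 0 i - _.
have eK : e * K = K * g w 0 i - (Num.floor (K * g w 0 i))%:~R.
  by rewrite /e mulrBl divfK ?gt_eqF // [_ * K]mulrC.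
have e0 : 0 <= e by rewrite -(pmulr_lge0 _ K0) eK subr_ge0.
have e1 : e <= K^-1.
  by rewrite -[leRHS]mul1r ler_pdivlMr // eK lerBlDl ltW // -intrD1.
have := coord_V j w i; rewrite ler_norml => /andP[V0 _].
have : 0 <= e * (V j w 0 i + 1) by rewrite mulr_ge0 //; lra.
rewrite mulrDr mulr1 => eV.
by rewrite -subr_ge0 opprK (le_trans eV) // lerD2l.
Qed.

(** For directions independent of the past and a vector [g] determined by the
    past, the half-space bound holds conditionally on the past. *)
Lemma conditional_halfspace E : <<s M >> E ->
  (c%:E * P E <=
   P (E `&` [set w | (forall j, 0 <= dotv (g w) (V j w))%R]))%E.
Proof.
move=> ME.
pose A N := E `&` [set w | forall j, - (n%:R / N.+1%:R) <= dotv (g w) (V j w)].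
have mE := sub_M ME.
have -> : E `&` [set w | forall j, 0 <= dotv (g w) (V j w)] = \bigcap_N A N.
  apply/seteqP; split => [w [Ew h] N _|w h].
    by split => // j; apply: le_trans (h j); rewrite oppr_le0 divr_ge0.
  split => [|j]; first by have [] := h 0%N I.
  have lim0 : (fun N => - (n%:R / N.+1%:R) : R) @ \oo --> (0 : R).
    rewrite -oppr0 -(mulr0 n%:R); apply: cvgN; apply: cvgM; first exact: cvg_cst.
    exact: cvg_harmonic.
  by apply: (cvgr_to_le lim0); apply: nearW => N; have [_] := h N I.
have mA N : measurable (A N) by apply: measurableI.
have PA : P \o A @ \oo --> P (\bigcap_N A N).
  apply: nonincreasing_cvg_mu => //.
  - by rewrite ltey_eq fin_num_measure.
  - exact: bigcapT_measurable.
  - move=> N N' NN'; apply/subsetPset => w [Ew h]; split => // j.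
    apply: le_trans (h j); rewrite lerN2 ler_wpM2l // lef_pV2 ?posrE //.
    by rewrite ler_nat ltnS.
by apply: (cvge_to_ge PA); apply: nearW => N; exact: rounded_halfspace.
Qed.

End conditioning_on_past.

(** * Confinement of the iterates *)

Section pds_confinement.
Context {d : measure_display} {Omega : measurableType d} {R : realType}.
Context {P : probability Omega R} {n m : nat}.
Variables (f : 'rV[R]_n -> R) (x0 : 'rV[R]_n) (alpha0 theta gamma : R).
Variable rho : R -> R.
Variable D : nat -> 'I_m -> {RV P >-> 'rV[R]_n}.
Variable X : nat -> {RV P >-> 'rV[R]_n}.
Variable A : nat -> {RV P >-> R}.

Let F := pds_filtration D X.

(* The generating sets of [F k]. *)
Let generators k := \bigcup_(i in `I_k)
  (g_sigma_preimage (D i) `|` g_sigma_algebra_preimage (X i.+1)).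

Let F_measurable k E : F k E -> measurable E.
Proof.
apply: smallest_sub; first exact: sigma_algebra_measurable.
move=> S [i _ [|]].
  apply: smallest_sub; first exact: sigma_algebra_measurable.
  move=> C; elim/big_ind : _ => [[]|C1 C2 h1 h2 [/h1|/h2]|j _ [B mB <-]] //.
  exact: measurable_funPT.
by move=> [B mB <-]; exact: measurable_funPT.
Qed.

Let FS k E : F k E -> F k.+1 E.
Proof.
apply: sub_sigma_algebra2 => S [i ik h]; exists i => //=.
exact: ltn_trans ik (ltnSn k).
Qed.

Let FI k E1 E2 : F k E1 -> F k E2 -> F k (E1 `&` E2).
Proof. exact: (@measurableI _ (g_sigma_algebraType (generators k))). Qed.

Let FC k E : F k E -> F k (~` E).
Proof. exact: (@measurableC _ (g_sigma_algebraType (generators k))). Qed.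

Hypothesis hpds : probabilistic_direct_search f x0 alpha0 theta gamma rho D X A.

Let F_iterate k B : measurable B -> F k (X k @^-1` B).
Proof.
move=> mB; case: k => [|k]; last first.
  apply: sub_sigma_algebra; exists k => //=; right.
  by exists B => //; rewrite setTI.
have -> : X 0 @^-1` B = [set _ | B x0].
  by apply/seteqP; split => w /=; rewrite (pds_X0 hpds).
case: (pselect (B x0)) => h.
  rewrite [X in F 0 X](_ : _ = setT); last by apply/seteqP; split.
  exact: (@measurableT _ (g_sigma_algebraType (generators 0))).
rewrite [X in F 0 X](_ : _ = set0); last by apply/seteqP; split.
exact: (@measurable0 _ (g_sigma_algebraType (generators 0))).
Qed.

Let F_direction k j B : measurable B -> F k.+1 (D k j @^-1` B).
Proof.
move=> mB; apply: sub_sigma_algebra; exists k => //=; left.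
apply: sub_sigma_algebra; rewrite (bigD1 j) //=; left.
by exists B => //; rewrite setTI.
Qed.

Hypothesis df : forall x, differentiable f x.

(** The event that no direction polled at iteration [k] is a descent
    direction of [f] at the current iterate; for a convex [f] such an
    iteration fails. *)
Definition no_descent k : set Omega :=
  [set w | forall j, 0 <= dotv (gradient f (X k w)) (D k j w)].

Let F_gradient k i B : measurable B ->
  F k [set w | B (gradient f (X k w) 0 i)].
Proof.
move=> mB; have := @F_iterate k _ (measurable_gradient df i measurableT mB).
by rewrite setTI.
Qed.

Let F_no_descent k : F k.+1 (no_descent k).
Proof.
pose Past := g_sigma_algebraType (generators k.+1).
have mg i : measurable_fun [set: Past] (fun w => gradient f (X k w) 0 i).
  by move=> _ B mB; rewrite setTI; apply: FS; exact: F_gradient.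
have mD j i : measurable_fun [set: Past] (fun w => D k j w 0 i).
  move=> _ B mB; rewrite setTI.
  have := @F_direction k j _ (measurable_coord i measurableT mB).
  by rewrite setTI.
rewrite [X in F _ X](_ : _ = \bigcap_(j in [set: 'I_m])
    ((fun w => dotv (gradient f (X k w)) (D k j w)) @^-1` `[0, +oo[)).
  apply: (@fin_bigcap_measurable _ Past) => // j _.
  have mdot : measurable_fun [set: Past]
      (fun w => dotv (gradient f (X k w)) (D k j w)).
    by apply: measurable_sum => i; exact: measurable_funM.
  by rewrite -[_ @^-1` _]setTI; apply: mdot => //; exact: measurable_itv.
apply/seteqP; split => [w h j _|w h j] /=; first by rewrite in_itv /= andbT; exact: h.
by have := h j I; rewrite /= in_itv /= andbT.
Qed.

Hypothesis unif : forall k j, uniform_on_sphere (D k j).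
Hypothesis iid : forall k, mutually_independent (D k).
Hypothesis past : forall k,
  independent_set_systems P (g_sigma_preimage (D k)) (pds_filtration D X k).

Let prob_no_descent k E : F k E ->
  2 ^- m * fine (P E) <= fine (P (E `&` no_descent k)).
Proof.
move=> FE; have mE := F_measurable FE.
have mEB : measurable (E `&` no_descent k).
  by apply: measurableI => //; exact: F_measurable (@F_no_descent k).
rewrite -lee_fin EFinM !fineK ?fin_num_measure //.
have norm1 j w : norm2 (D k j w) = 1 by exact: pds_unit hpds k j w.
apply: conditional_halfspace FE => //.
- exact: F_measurable.
- exact: F_gradient.
- move=> v; exact: iid_uniform_halfspace.
Qed.

Hypothesis cvx : convex_function [set: 'rV[R]_n] f.
Hypotheses (alpha00 : 0 < alpha0) (theta01 : 0 < theta < 1) (gamma1 : 1 <= gamma).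
Hypothesis rho_gt0 : forall a, 0 < a -> 0 < rho a.

Let theta0 : 0 < theta. Proof. by case/andP: theta01. Qed.
Let theta_gamma : theta <= gamma.
Proof. by case/andP: theta01 => _ /ltW /le_trans; apply. Qed.
Let gamma0 : 0 < gamma. Proof. exact: lt_le_trans ltr01 gamma1. Qed.

Let step_gt0 k w : 0 < A k w.
Proof.
elim: k => [|k IH]; first by rewrite (pds_A0 hpds).
have [s|s] := pselect (exists j, sufficient_decrease f rho D X A k w j).
  by have [_ ->] := pds_success hpds s; rewrite mulr_gt0.
by have [_ ->] := pds_failure hpds s; rewrite mulr_gt0.
Qed.

Let no_descent_fails k w : no_descent k w ->
  X k.+1 w = X k w /\ A k.+1 w = theta * A k w.
Proof.
move=> nd; apply: (pds_failure hpds) => -[j]; rewrite /sufficient_decrease.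
apply/negP; rewrite -leNgt.
have := convex_gradient df (X k w) (A k w *: D k j w) cvx.
rewrite dotvZr.
have : 0 <= A k w * dotv (gradient f (X k w)) (D k j w).
  by rewrite mulr_ge0 ?(ltW (step_gt0 k w)) // nd.
by have := rho_gt0 (step_gt0 k w); lra.
Qed.

Let step_growth k w : A k.+1 w <= gamma * A k w.
Proof.
have [s|s] := pselect (exists j, sufficient_decrease f rho D X A k w j).
  by have [_ ->] := pds_success hpds s.
have [_ ->] := pds_failure hpds s.
by rewrite ler_wpM2r ?(ltW (step_gt0 k w)).
Qed.

Let move_le_step k w : `|X k.+1 w - X k w| <= A k w.
Proof.
have [s|s] := pselect (exists j, sufficient_decrease f rho D X A k w j).
  have [[j _ ->] _] := pds_success hpds s.
  rewrite addrAC subrr add0r normrZ gtr0_norm ?step_gt0 //.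
  rewrite -[leRHS]mulr1 ler_wpM2l ?(ltW (step_gt0 k w)) //.
  by rewrite -(pds_unit hpds k j w) ler_mx_norm2.
by have [-> _] := pds_failure hpds s; rewrite subrr normr0 ltW // step_gt0.
Qed.

Variables s eta : R.
Hypotheses (s0 : 0 < s) (eta01 : 0 < eta < 1).
Hypothesis contraction :
  2 ^- m * theta `^ s + (1 - 2 ^- m) * gamma `^ s <= eta `^ s.

Let eta0 : 0 < eta. Proof. by case/andP: eta01. Qed.
Let eta1 : 0 < 1 - eta. Proof. by case/andP: eta01 => _; rewrite subr_gt0. Qed.
Let over := overshoot no_descent theta gamma eta.

Let step_le_envelope N k a r w : ~ over N k a r w -> A k w <= a ->
  A (k + N)%N w <= r * eta ^+ N.
Proof.
elim: N k a r => [|N IH] k a r nover Aa.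
  rewrite addn0 expr0 mulr1 leNgt; apply/negP => rA; apply: nover; left => /=.
  exact: lt_le_trans Aa.
rewrite addnS -addSn exprS mulrA.
have [nd|nd] := pselect (no_descent k w).
  apply: (IH k.+1 (theta * a)).
    by move=> o; apply: nover; right; left.
  by have [_ ->] := no_descent_fails nd; rewrite ler_wpM2l // ltW.
apply: (IH k.+1 (gamma * a)).
  by move=> o; apply: nover; right; right.
by rewrite (le_trans (step_growth k w)) // ler_wpM2l // ltW.
Qed.

(** The event that the first [K] iterations poll no descent direction. *)
Let stalls K := \big[setI/setT]_(k < K) no_descent k.

Let stalls_state K w : stalls K w ->
  (forall k, (k <= K)%N -> X k w = x0) /\ A K w = theta ^+ K * alpha0.
Proof.
elim: K => [_|K IH].
  rewrite expr0 mul1r (pds_A0 hpds); split => // k.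
  by rewrite leqn0 => /eqP ->; exact: pds_X0 hpds w.
rewrite /stalls big_ord_recr /= => -[/IH [XK AK] /no_descent_fails [X1 A1]].
split; last by rewrite A1 AK exprS mulrA.
by move=> k; rewrite leq_eqVlt => /orP[/eqP ->|/XK //]; rewrite X1 XK.
Qed.

Let F_stalls K : F K (stalls K).
Proof.
elim: K => [|K IH].
  rewrite /stalls big_ord0.
  exact: (@measurableT _ (g_sigma_algebraType (generators 0))).
by rewrite /stalls big_ord_recr; apply: FI; [exact: FS | exact: F_no_descent].
Qed.

Let prob_stalls K : (2 ^- m) ^+ K <= fine (P (stalls K)).
Proof.
elim: K => [|K IH]; first by rewrite /stalls big_ord0 expr0 probability_setT.
rewrite /stalls big_ord_recr /= exprS.
apply: le_trans (prob_no_descent (@F_stalls K)).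
by rewrite ler_wpM2l // invr_ge0 exprn_ge0.
Qed.

(** The iterates stay within [r / (1 - eta)] of the starting point as soon as
    the first [K] iterations stall and the later step sizes do not overshoot
    the envelope [r * eta ^+ j].  The event of interest enters through a
    measurable event [Y] that contains it. *)
Lemma prob_confined K r (Y : set Omega) : 0 < r -> measurable Y ->
  (forall w, (forall k, `|X k w - x0| <= r / (1 - eta)) -> Y w) ->
  (2 ^- m) ^+ K * (1 - (theta ^+ K * alpha0 / r) `^ s) <= fine (P Y).
Proof.
move=> r0 mY confY.
have [r1|r1] := leP 1 ((theta ^+ K * alpha0 / r) `^ s).
  apply: (@le_trans _ _ 0); last exact: fine_ge0.
  by rewrite mulr_ge0_le0 ?subr_le0 // exprn_ge0 // invr_ge0 exprn_ge0.
pose a := theta ^+ K * alpha0.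
have a0 : 0 < a by rewrite mulr_gt0 // exprn_gt0.
have mstalls : measurable (stalls K) by exact: F_measurable (@F_stalls K).
have mover N : measurable (over N K a r).
  by apply: measurable_overshoot => k; exact: F_measurable (@F_no_descent k).
pose O := \bigcup_N over N K a r.
have mO : measurable O by exact: bigcupT_measurable.
(* The maximal inequality, applied from time [K] on. *)
have over_le N : (P (stalls K `&` over N K a r) <=
    (fine (P (stalls K)) * (a / r) `^ s)%:E)%E.
  rewrite -[P _]fineK ?fin_num_measure //; last exact: measurableI.
  rewrite lee_fin powRM ?(ltW a0) ?invr_ge0 ?(ltW r0) //.
  rewrite -powR_inv1 ?(ltW r0) // -powRrM mulN1r powRN mulrA ler_pdivlMr ?powR_gt0 //.
  apply: (@prob_overshoot _ _ _ P no_descent _ _ _ _ F (2 ^- m)) => //.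
  - by move=> k; exact: F_measurable (@F_no_descent k).
  - by rewrite theta0.
  - by move=> k E FE; apply: FI; [exact: FS | exact: F_no_descent].
  - by move=> k E FE; apply: FI; [exact: FS | apply: FC; exact: F_no_descent].
have O_le : fine (P (stalls K `&` O)) <= fine (P (stalls K)) * (a / r) `^ s.
  rewrite -lee_fin fineK ?fin_num_measure //; last exact: measurableI.
  rewrite /O setI_bigcupr.
  have PO : P \o (fun N => stalls K `&` over N K a r) @ \oo -->
      P (\bigcup_N (stalls K `&` over N K a r)).
    apply: nondecreasing_cvg_mu.
    - by move=> N; exact: measurableI.
    - by rewrite -setI_bigcupr; exact: measurableI.
    - apply/nondecreasing_seqP => N; apply/subsetPset; apply: setIS.
      exact: overshootS.
  by apply: (cvge_to_le PO); exact: nearW.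
have mSO : measurable (stalls K `\` O) by exact: measurableD.
have sub : stalls K `\` O `<=` Y.
  move=> w [stw nO]; apply: confY.
  have [XK AK] := stalls_state stw.
  have envelope j : A (K + j)%N w <= r * eta ^+ j.
    apply: (@step_le_envelope j K a) => [ow|]; last by rewrite AK.
    by apply: nO; exists j.
  (* The bound is r (1 + eta + ... + eta^(j-1)), cleared of denominators. *)
  have dist j : `|X (K + j)%N w - x0| * (1 - eta) <= r * (1 - eta ^+ j).
    elim: j => [|j IH].
      by rewrite addn0 XK // subrr normr0 mul0r expr0 subrr mulr0.
    have tri : `|X (K + j.+1)%N w - x0| <= `|X (K + j)%N w - x0| + r * eta ^+ j.
      have -> : X (K + j.+1)%N w - x0 =
          (X (K + j)%N w - x0) + (X (K + j).+1 w - X (K + j)%N w).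
        by rewrite addnS [RHS]addrC subrKA.
      rewrite (le_trans (ler_normD _ _)) // lerD2l.
      exact: le_trans (move_le_step _ _) (envelope j).
    have /ler_wpM2r -/(_ _ _ tri) := ltW eta1.
    by rewrite exprS; lra.
  move=> k; rewrite ler_pdivlMr //.
  have [kK|Kk] := leqP k K.
    by rewrite XK // subrr normr0 mul0r ltW.
  rewrite -(subnKC (ltnW Kk)) (le_trans (dist _)) // ler_piMr ?(ltW r0) //.
  by rewrite gerBl exprn_ge0 // ltW.
have split_stalls : fine (P (stalls K)) =
    fine (P (stalls K `\` O)) + fine (P (stalls K `&` O)).
  have mSI : measurable (stalls K `&` O) by exact: measurableI.
  rewrite -fineD ?fin_num_measure //; congr fine; exact: measureDI.
apply: (@le_trans _ _ (fine (P (stalls K)) * (1 - (a / r) `^ s))).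
  by rewrite ler_wpM2r ?prob_stalls // subr_ge0 ltW.
apply: (@le_trans _ _ (fine (P (stalls K `\` O)))); first by lra.
by rewrite fine_le ?fin_num_measure // le_measure ?inE.
Qed.

End pds_confinement.

(** * Bounds on the probability of staying near the starting point *)

Lemma powR_ln_ratio (R : realType) (theta p : R) K :
  0 < theta < 1 -> 0 < p -> (theta ^+ K) `^ (ln p / ln theta) = p ^+ K.
Proof.
move=> /andP[theta0 theta1] p0.
have lnt : ln theta != 0 by rewrite lt_eqF // ln_lt0 // theta0.
have -> : p ^+ K = (theta `^ (ln p / ln theta)) `^ K%:R.
  by rewrite {2}/powR gt_eqF // divfK // lnK ?posrE // powR_mulrn // ltW.
by rewrite -powRrM -[theta ^+ K]powR_mulrn ?(ltW theta0) // -powRrM mulrC.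
Qed.

(** A threshold below 1 is matched by some power of [theta] up to a factor
    [theta]. *)
Lemma geometric_threshold (R : realType) (theta c : R) :
  0 < theta < 1 -> 0 < c < 1 -> exists K, theta * c < theta ^+ K <= c.
Proof.
move=> /andP[theta0 theta1] /andP[c0 c1].
have exK : exists K, theta ^+ K <= c.
  have : (GRing.exp theta : R ^nat) @ \oo --> 0.
    by apply: cvg_expr; rewrite gtr0_norm.
  by move=> /cvgr_le /(_ _ c0) [K _ h]; exists K; apply: h => /=.
have := ex_minnP exK => -[[|K] hK minK]; first by move: hK; rewrite expr0 leNgt c1.
exists K.+1; rewrite hK andbT exprS ltr_pM2l // ltNge.
by apply/negP => /minK; rewrite ltnn.
Qed.

(** The condition on the number of directions says that the logarithm of a step
    size that shrinks with probability [2 ^- m] and grows otherwise decreases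
    on average. *)
Lemma pds_drift (R : realType) (theta gamma : R) (m : nat) :
  0 < theta < 1 ->
  gamma = 1 \/ 1 < gamma /\ m%:R < ln (1 - ln theta / ln gamma) / ln 2 ->
  (1 - 2 ^- m) * ln gamma + 2 ^- m * ln theta < 0.
Proof.
move=> theta01; have lnt : ln theta < 0 by exact: ln_lt0.
have p0 : 0 < (2 ^- m : R) by rewrite invr_gt0 exprn_gt0.
case=> [->|[gamma1]]; first by rewrite ln1 mulr0 add0r pmulr_rlt0.
have lng : 0 < ln gamma by rewrite ln_gt0.
have ln20 : 0 < ln (2 : R) by rewrite ln_gt0 // ltr1n.
rewrite ltr_pdivlMr // mulr_natl -lnXn // ltr_ln ?posrE ?exprn_gt0 //; last first.
  by rewrite subr_gt0 (@lt_trans _ _ 0) // pmulr_llt0 ?invr_gt0.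
move=> h2m.
have {}h2m : 2 ^+ m * ln gamma < ln gamma - ln theta.
  by move: h2m; rewrite -(ltr_pM2r lng) mulrBl mul1r divfK // gt_eqF.
rewrite -(ltr_pM2l p0) mulrA mulVf ?gt_eqF ?exprn_gt0 // mul1r in h2m.
by lra.
Qed.

Lemma measurable_fun_ereal_inf d (T : measurableType d) (R : realType)
    (u : nat -> T -> \bar R) :
  (forall k, measurable_fun setT (u k)) ->
  measurable_fun setT (fun x => ereal_inf (range (u ^~ x))).
Proof.
move=> mu; have := measurable_fun_einfs mu 0%N; congr (measurable_fun _ _).
by apply/funext => x; congr ereal_inf; apply/seteqP; split => y [k _ <-]; exists k.
Qed.

Theorem corollary3p1 (R : realType) (n m : nat) (hn : (0 < n)%N) (hm : (0 < m)%N)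
    (f : 'rV[R]_n -> R) (x0 : 'rV[R]_n) (alpha0 theta gamma : R) (rho : R -> R)
    (halpha0 : 0 < alpha0) (htheta : 0 < theta < 1) (hgamma : 1 <= gamma)
    (hrho : forcing_function rho)
    (d : measure_display) (Omega : measurableType d) (P : probability Omega R)
    (D : nat -> 'I_m -> {RV P >-> 'rV[R]_n}) (X : nat -> {RV P >-> 'rV[R]_n})
    (A : nat -> {RV P >-> R})
    (hpds : probabilistic_direct_search f x0 alpha0 theta gamma rho D X A)
    (hdiff : forall x, differentiable f x)
    (hconv : convex_function [set: 'rV[R]_n] f)
    (hunif : forall k j, uniform_on_sphere (D k j))
    (hiid : forall k, mutually_independent (D k))
    (hpast : forall k, independent_set_systems P
                         (g_sigma_preimage (D k)) (pds_filtration D X k))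
    (hm_gamma : gamma = 1 \/
                1 < gamma /\ m%:R < ln (1 - ln theta / ln gamma) / ln 2)
    (mu : 'rV[R]_n -> \bar R) (hmu_Ny : forall x, (-oo < mu x)%E)
    (hmu_lsc : lower_semicontinuous mu) (hmu_x0 : (0 < mu x0)%E) :
  (0 < P [set w | (0 < ereal_inf (range (fun k => mu (X k w))))%E])%E /\
  (locally_lipschitz_at mu x0 ->
   exists C zeta_bar : R, [/\ 0 < C, 0 < zeta_bar &
     forall zeta, 0 < zeta < zeta_bar ->
       ((C * zeta `^ (ln (2 ^- m) / ln theta))%:E <=
        P [set w | ((1 - zeta)%:E * mu x0 <=
                    ereal_inf (range (fun k => mu (X k w))))%E])%E]).
Proof.
have [rho_gt0 _ _] := hrho.
have [theta0 theta1] := andP htheta.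
have p01 : 0 < (2 ^- m : R) < 1.
  by rewrite invr_gt0 exprn_gt0 //= invf_lt1 ?exprn_gt0 // exprn_egt1 ?ltr1n // -lt0n.
have p0 : 0 < (2 ^- m : R) by case/andP: p01.
have [s [eta [s0 eta01 contr]]] :=
  drift_exponent htheta hgamma p01 (pds_drift htheta hm_gamma).
have eta1 : 0 < 1 - eta by case/andP: eta01; lra.
have confined := prob_confined hpds hdiff hunif hiid hpast hconv halpha0
  htheta hgamma rho_gt0 s0 eta01 contr.
(* Both events of the claim are measurable, as preimages of intervals under the
   infimum. *)
have minf : measurable_fun setT
    (fun w => ereal_inf (range (fun k => mu (X k w)))).
  apply: measurable_fun_ereal_inf => k.
  exact: measurableT_comp (lower_semicontinuous_measurable_rV hmu_lsc)
    (measurable_funPT (X k)).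
have mY (i : interval (\bar R)) :
    measurable [set w | ereal_inf (range (fun k => mu (X k w))) \in i].
  by have := minf measurableT _ (emeasurable_itv i); rewrite setTI.
split.
  set Y := [set w | _].
  have mYpos : measurable Y.
    by have := mY `]0%E, +oo[; congr measurable; apply/seteqP; split => w /=;
      rewrite in_itv /= ?andbT.
  have [c c0 cmu] : exists2 c : R, 0 < c & (c%:E < mu x0)%E.
    move: hmu_x0; case: (mu x0) => [r| |] //.
      by rewrite lte_fin => r0; exists (r / 2); rewrite ?lte_fin; lra.
    by move=> _; exists 1; rewrite ?ltry.
  have [V /nbhs_ballP[e /= e0 eV] Vc] := hmu_lsc _ _ cmu.
  (* The confinement radius [r / (1 - eta)] is then [e / 2]. *)
  pose r := (1 - eta) * (e / 2).
  have r0 : 0 < r by rewrite mulr_gt0 // divr_gt0.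
  have t01 : 0 < Num.min (2^-1) (r / (2 * alpha0)) < 1.
    rewrite lt_min gt_min; apply/andP; split.
      by rewrite invr_gt0 ltr0n /= divr_gt0 // mulr_gt0.
    by rewrite invf_lt1 ?ltr1n.
  have [K /andP[_]] := geometric_threshold htheta t01.
  rewrite le_min => /andP[_ Kr].
  have base1 : theta ^+ K * alpha0 / r < 1.
    rewrite ltr_pdivrMr // mul1r.
    move: Kr; rewrite -(ler_pM2r halpha0) invfM mulrA divfK ?gt_eqF //.
    by move=> /le_lt_trans; apply; lra.
  have pow1 : (theta ^+ K * alpha0 / r) `^ s < 1.
    rewrite -[ltRHS](_ : 1 `^ s = _); last by rewrite powR1.
    rewrite gt0_ltr_powR ?nnegrE //.
    by rewrite divr_ge0 // ?(ltW r0) // mulr_ge0 ?exprn_ge0 // ltW.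
  rewrite -[P Y]fineK ?fin_num_measure // lte_fin.
  apply: (@lt_le_trans _ _ _ _ _ _ (confined K r Y r0 mYpos _)).
    by rewrite mulr_gt0 ?exprn_gt0 // subr_gt0.
  move=> w near_x0; apply: (@lt_le_trans _ _ c%:E); first by rewrite lte_fin.
  apply: le_ereal_inf_tmp => _ [k _ <-]; apply/ltW/Vc/eV.
  rewrite -ball_normE /= distrC (le_lt_trans (near_x0 k)) //.
  by rewrite /r mulrAC divff ?gt_eqF // mul1r; lra.
move=> [V /nbhs_ballP[e /= e0 eV] [fin_mu lip]].
have [L L0 lipL] := pinfty_ex_gt0 lip.
have Vx0 : V x0 by apply: eV; exact: ballxx.
pose M := fine (mu x0).
have muM : mu x0 = M%:E by rewrite fineK // fin_mu.
have M0 : 0 < M by move: hmu_x0; rewrite muM lte_fin.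
(* Iterates confined to distance [z * M / L] keep [mu] above [(1 - z) * M]; this
   distance is [r / (1 - eta)] for [r = c1 * z]. *)
pose c1 := (1 - eta) * M / L.
have c10 : 0 < c1 by rewrite divr_gt0 // mulr_gt0.
(* As [h `^ s = 1 / 2], the step size [theta ^+ K * alpha0] overshoots with
   probability at most 1 / 2 once [theta ^+ K <= c2 * z]. *)
pose h := 2^-1 `^ s^-1.
have h0 : 0 < h by rewrite powR_gt0 // invr_gt0.
pose c2 := h * c1 / alpha0.
have c20 : 0 < c2 by rewrite divr_gt0 // mulr_gt0.
pose q := ln (2 ^- m) / ln theta.
have q0 : 0 < q.
  rewrite -[ltLHS](mulr0 (ln (2 ^- m))) ltr_nM2l ?invr_lt0 ln_lt0 //.
(* The two bounds on [z] put the confinement ball inside [V] and make [c2 * z]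
   less than 1. *)
exists ((theta * c2) `^ q / 2), (Num.min (e * L / M) c2^-1); split.
- by rewrite divr_gt0 // powR_gt0 // mulr_gt0.
- by rewrite lt_min invr_gt0 c20 divr_gt0 // mulr_gt0.
move=> z /andP[z0]; rewrite lt_min => /andP[ze zc].
set Y := [set w | _].
have mYge : measurable Y.
  by have := mY `[((1 - z)%:E * mu x0)%E, +oo[; congr measurable;
    apply/seteqP; split => w /=; rewrite in_itv /= ?andbT.
have t01 : 0 < c2 * z < 1.
  by rewrite mulr_gt0 //= mulrC -ltr_pdivlMr // mul1r.
have [K /andP[Kgt Kle]] := geometric_threshold htheta t01.
pose r := c1 * z.
have r0 : 0 < r by rewrite mulr_gt0.
have pow_le : (theta ^+ K * alpha0 / r) `^ s <= 2^-1.
  have -> : (2^-1 : R) = h `^ s.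
    by rewrite /h -powRrM mulVf ?gt_eqF // powRr1 // invr_ge0.
  rewrite ge0_ler_powR ?nnegrE ?(ltW s0) ?(ltW h0) //.
    by rewrite divr_ge0 // ?(ltW r0) // mulr_ge0 ?exprn_ge0 // ltW.
  rewrite ler_pdivrMr // -ler_pdivlMr //.
  by apply: (le_trans Kle); rewrite /c2 /r; lra.
have conf : (2 ^- m) ^+ K * (1 - (theta ^+ K * alpha0 / r) `^ s) <= fine (P Y).
  apply: confined => // w near_x0; rewrite /Y /= muM -EFinM.
  have rE : r / (1 - eta) = z * M / L.
    by rewrite /r /c1; field; rewrite !gt_eqF.
  apply: le_ereal_inf_tmp => _ [k _ <-].
  have Vk : V (X k w).
    apply: eV; rewrite -ball_normE /= distrC (le_lt_trans (near_x0 k)) // rE.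
    by rewrite ltr_pdivrMr // -ltr_pdivlMr.
  rewrite -[mu _]fineK ?lee_fin; last exact: fin_mu.
  have lipk : `|M - fine (mu (X k w))| <= L * `|x0 - X k w| :=
    lipL (x0, X k w) (conj Vx0 Vk).
  have : `|M - fine (mu (X k w))| <= z * M.
    apply: (le_trans lipk); rewrite mulrC -ler_pdivlMr // distrC -rE.
    exact: near_x0.
  by rewrite ler_norml => /andP[_]; lra.
rewrite -[P Y]fineK ?fin_num_measure // lee_fin.
apply: le_trans conf.
apply: (@le_trans _ _ ((2 ^- m) ^+ K / 2)); last first.
  by rewrite ler_pM2l ?exprn_gt0 //; lra.
rewrite -(powR_ln_ratio K htheta p0) -/q mulrAC ler_pM2r ?invr_gt0 //.
have tc0 : 0 <= theta * c2 by rewrite mulr_ge0 // ltW.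
rewrite -powRM ?(ltW z0) //; apply: ge0_ler_powR; rewrite ?nnegrE ?(ltW q0) //.
- by rewrite mulr_ge0 // ltW.
- by rewrite exprn_ge0 // ltW.
- by rewrite -mulrA ltW.
Qed.
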